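(* Let $K$ be a field satisfying the following two conditions: (i) $K$ admits a proper adelic structure with Northcott's property; (ii) there is a positive integer $p_0$ such that $F_p(K)$ is finite for every prime number $p \geqslant p_0$. Then \[ \lim_{m\to\infty} \frac{\#\{ N \in \mathbb{Z} \mid 1 \leqslant N \leqslant m \text{ and } F_N \text{ has Fermat's property over } K \}}{m} = 1. \]
   Context: For a positive integer $N$, the Fermat curve of degree $N$ is $F_N = \operatorname{Proj}(\mathbb{Z}[X,Y,Z]/(X^N+Y^N-Z^N))$; $F_N(K)$ denotes its set of $K$-points, i.e. the points $(x:y:z)\in\mathbb{P}^2(K)$ with $x^N+y^N=z^N$. Let $\mu(K)=\{x\in K\mid x^n=1 \text{ for some } n\in\mathbb{Z}_{\geqslant 1}\}$. We say $F_N$ has Fermat's property over $K$ if $\{(x,y)\in K^2 \mid x^N+y^N=1\}\subseteq (\{0\}\cup\mu(K))^2$. An adelic structure of $K$ is data $S=(K,(\Omega,\mathcal{A},\nu),\phi)$ where $(\Omega,\mathcal{A},\nu)$ is a measure space, $\phi:\Omega\to M_K$ is a map to the set $M_K$ of absolute values of $K$ (write $|\cdot|_\omega=\phi(\omega)$), and for each $a\in K^\times$ the function $\omega\mapsto\log|a|_\omega$ is $\nu$-integrable. It is proper if $\int_\Omega \log|a|_\omega\,\nu(d\omega)=0$ for all $a\in K^\times$. It has Northcott's property if for every $C\in\mathbb{R}$ the set $\{a\in K \mid \int_\Omega \log\max\{|a|_\omega,1\}\,\nu(d\omega)\leqslant C\}$ is finite. *)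

(* Defs.v *)
From HB Require Import structures.
From mathcomp Require Import all_boot all_order all_algebra.
From mathcomp Require Import finmap all_classical all_reals all_analysis.
Set Implicit Arguments.
Unset Strict Implicit.
Unset Printing Implicit Defensive.
Import Order.TTheory GRing.Theory Num.Theory numFieldNormedType.Exports.
Local Open Scope classical_set_scope.
Local Open Scope ring_scope.

(* Archimedean or not; the trivial absolute value is allowed. *)
Record absolute_value (R : realType) (K : fieldType) := AbsoluteValue {
  absv :> K -> R ;
  absv_ge0 : forall x, 0 <= absv x ;
  absv_eq0 : forall x, absv x = 0 <-> x = 0 ;
  absvM : forall x y, absv (x * y) = absv x * absv y ;
  absvD : forall x y, absv (x + y) <= absv x + absv y }.

Record adelic_structure (R : realType) (K : fieldType) := AdelicStructure {
  adelic_disp : measure_display ;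
  adelic_space : measurableType adelic_disp ;
  adelic_measure : {measure set adelic_space -> \bar R} ;
  adelic_absv : adelic_space -> absolute_value R K ;
  adelic_integrable : forall a : K, a != 0 ->
    adelic_measure.-integrable [set: adelic_space]
      (fun w => (ln (adelic_absv w a))%:E) }.

Definition adelic_proper (R : realType) (K : fieldType)
    (S : adelic_structure R K) : Prop :=
  forall a : K, a != 0 ->
    (\int[adelic_measure S]_w (ln (adelic_absv w a))%:E = 0)%E.

Definition adelic_northcott (R : realType) (K : fieldType)
    (S : adelic_structure R K) : Prop :=
  forall C : R, finite_set [set a : K |
    (\int[adelic_measure S]_w (ln (Num.max (adelic_absv w a) 1))%:E <= C%:E)%E].

(* A point (x : y : z) of P^2(K) is the line spanned by a nonzero row vector
   (x, y, z) of K^3. *)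
Definition fermat_points (K : fieldType) (N : nat) : set {vspace 'rV[K]_3} :=
  [set L | exists v : 'rV[K]_3,
    [/\ v != 0, L = <[v]>%VS & v 0 0 ^+ N + v 0 1 ^+ N = v 0 2 ^+ N]].
Arguments fermat_points : clear implicits.

Definition roots_of_unity (K : fieldType) : set K :=
  [set x | exists2 n : nat, (1 <= n)%N & x ^+ n = 1].
Arguments roots_of_unity : clear implicits.

Definition fermat_property (K : fieldType) (N : nat) : Prop :=
  [set xy : K * K | xy.1 ^+ N + xy.2 ^+ N = 1] `<=`
  ([set 0] `|` roots_of_unity K) `*` ([set 0] `|` roots_of_unity K).

Definition fermat_count (K : fieldType) (m : nat) : nat :=
  #|` fset_set [set N : nat | (1 <= N <= m)%N /\ fermat_property K N]|%fset.

(* Main.v *)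
Require Import Defs.
From HB Require Import structures.
From mathcomp Require Import all_boot all_order all_algebra.
From mathcomp Require Import finmap all_classical all_reals all_analysis.
From mathcomp Require Import zify lra.
Set Implicit Arguments.
Unset Strict Implicit.
Unset Printing Implicit Defensive.
Import Order.TTheory GRing.Theory Num.Theory numFieldNormedType.Exports.
Local Open Scope classical_set_scope.
Local Open Scope ring_scope.

(** Heights satisfy [h (x ^ k) = k * h x], so by Northcott's property the
    elements of height 0 are 0 and the roots of unity, and a finite set contains
    the [k]-th power of an element of positive height for only finitely many
    [k].  A solution [(x, y)] for the exponent [p * k] yields the point
    [(x ^ k, y ^ k)] of the finite set of affine points of [F_p]; hence [F_(p k)]
    has Fermat's property for every large [k].  The exponents without it are
    thus, up to finitely many, coprime to every prime in any chosen finite set of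
    primes [p >= p0], and their upper density is at most the product of the
    [1 - 1/p], which can be made arbitrarily small because the harmonic series
    diverges (Euler). *)

(** * Truncated Euler products and the harmonic series *)

Lemma ler_sum_sub_uniq (R : numDomainType) (I : eqType) (s t : seq I)
    (F : I -> R) :
  uniq s -> uniq t -> {subset s <= t} -> (forall i, 0 <= F i) ->
  \sum_(i <- s) F i <= \sum_(i <- t) F i.
Proof.
move=> us ut sst F0; rewrite [leRHS](bigID (mem s)) /=.
rewrite -[X in X + _]big_filter [X in X + _](@perm_big _ _ _ _ _ s).
  by rewrite lerDl sumr_ge0.
apply: uniq_perm => [||i]; rewrite ?filter_uniq// mem_filter /=.
by apply: andb_idr; exact: sst.
Qed.

Definition smooth (j k : nat) := all (fun p => (p < j)%N) (primes k).

Definition smooth_sum (R : numFieldType) (j n : nat) : R :=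
  \sum_(k <- iota 1 n | smooth j k) k%:R^-1.

Lemma smoothS_not_prime j k : ~~ prime j -> smooth j.+1 k = smooth j k.
Proof.
move=> npj; apply: eq_in_all => p; rewrite mem_primes => /andP[pp _].
rewrite ltnS leq_eqVlt orb_idl// => /eqP pj.
by move: npj; rewrite -pj pp.
Qed.

Lemma smoothS_not_dvd j k : ~~ (j %| k)%N -> smooth j.+1 k = smooth j k.
Proof.
move=> njk; apply: eq_in_all => p; rewrite mem_primes => /and3P[_ _ pk].
rewrite ltnS leq_eqVlt orb_idl// => /eqP pj.
by move: njk; rewrite -pj pk.
Qed.

(* Euler's product one prime at a time, on sums truncated at [n]: the multiples
   of [j] contribute at most [1/j] times the whole sum. *)
Lemma smooth_sum_step (R : numFieldType) j n : prime j ->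
  smooth_sum R j.+1 n * (1 - j%:R^-1) <= smooth_sum R j n.
Proof.
move=> pj; rewrite mulrBr mulr1 lerBlDr.
rewrite [X in X <= _]/smooth_sum (bigID (dvdn j)) /= addrC lerD//.
  rewrite /smooth_sum [leRHS](bigID (dvdn j)) /= addrC.
  rewrite (eq_bigl (fun k => smooth j k && ~~ (j %| k)%N)) ?lerDl ?sumr_ge0//.
  move=> k /=; case: (boolP (j %| k)%N) => [_|/smoothS_not_dvd ->//].
  by rewrite !andbF.
(* A multiple [j * q] of [j] that is counted on the left has [q <= n], and the primes of [q] are
   among those of [j * q], so [q] is counted on the right. *)
rewrite /smooth_sum mulr_suml -big_filter -[leRHS]big_filter.
rewrite [leRHS](eq_bigr (fun k => (j * k)%:R^-1)); last first.
  by move=> k _; rewrite natrM invfM mulrC.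
rewrite -(big_map (muln j) xpredT (fun k => k%:R^-1)).
have j0 := prime_gt0 pj.
apply: ler_sum_sub_uniq; rewrite ?filter_uniq ?iota_uniq//.
  rewrite map_inj_uniq ?filter_uniq ?iota_uniq// => x y /eqP.
  by rewrite eqn_pmul2l// => /eqP.
move=> k; rewrite mem_filter mem_iota => /andP[/andP[sk /dvdnP[q kq]]] kn.
apply/mapP; exists q; last by rewrite kq mulnC.
have q0 : (0 < q)%N by rewrite lt0n; apply: contraTneq kn => q0; rewrite kq q0.
rewrite mem_filter mem_iota; apply/andP; split; last first.
  rewrite q0 /= (leq_ltn_trans _ (proj2 (andP kn)))// kq.
  by rewrite leq_pmulr.
apply/allP => p pq; apply: (allP sk); move: pq.
rewrite !mem_primes kq muln_gt0 q0 j0 => /and3P[-> _ pq] /=.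
by rewrite dvdn_mulr.
Qed.

Definition prime_prod (R : numFieldType) (i j : nat) : R :=
  \prod_(i <= p < j | prime p) (1 - p%:R^-1).

Lemma prime_factor_gt0 (R : numFieldType) p : prime p -> 0 < 1 - p%:R^-1 :> R.
Proof.
by move=> /prime_gt1 p1; rewrite subr_gt0 invf_lt1 ?ltr1n// ltr0n ltnW.
Qed.

Lemma prime_prod_gt0 (R : numFieldType) i j : 0 < prime_prod R i j.
Proof. by apply: prodr_gt0 => p; exact: prime_factor_gt0. Qed.

Lemma smooth_sum_prime_prod_le1 (R : numFieldType) j n :
  smooth_sum R j n * prime_prod R 0 j <= 1.
Proof.
elim: j => [|j ih].
  (* No prime is below 0, and any [k >= 2] has the prime factor [pdiv k]; only [k = 1] is left. *)
  rewrite /prime_prod big_geq// mulr1 /smooth_sum.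
  rewrite -big_filter; apply: (@le_trans _ _ (\sum_(k <- [:: 1%N]) k%:R^-1)).
    apply: ler_sum_sub_uniq; rewrite ?filter_uniq ?iota_uniq// => k.
    rewrite mem_filter mem_iota => /andP[sk /andP[k1 _]].
    rewrite inE eqn_leq k1 andbT leqNgt; apply/negP => k2.
    have := allP sk (pdiv k); rewrite mem_primes pdiv_prime// pdiv_dvd.
    by rewrite (ltnW k2) => /(_ isT).
  by rewrite big_seq1 invr1.
rewrite /prime_prod big_mkcond big_nat_recr//= -big_mkcond /=.
case: ifPn => [pj|npj].
  rewrite mulrCA mulrC (le_trans _ ih)// ler_pM2r ?prime_prod_gt0//.
  exact: smooth_sum_step.
rewrite mulr1 (le_trans _ ih)// ler_pM2r ?prime_prod_gt0//.
by rewrite /smooth_sum (eq_bigl (smooth j))// => k; exact: smoothS_not_prime.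
Qed.

Lemma series_harmonic_unbounded (R : realType) (C : R) :
  exists n, C < series harmonic n.
Proof.
apply: contrapT => /forallNP H; apply: (@dvg_harmonic R).
apply: nondecreasing_is_cvgn.
  by apply: nondecreasing_series => k _ _; exact: harmonic_ge0.
by exists C => _ [n _ <-]; rewrite leNgt; apply/negP/H.
Qed.

(** Once [j > n], every [k] from 1 to [n] is [j]-smooth, so the smooth sum is the harmonic sum, and
    the product over all primes below [j] is at most its inverse. The fixed factor from the primes
    below [i] is absorbed in the choice of [n]. *)
Lemma prime_prod_small (R : realType) i (e : R) : 0 < e ->
  exists2 j, (i <= j)%N & prime_prod R i j < e.
Proof.
move=> e0; have c0 := prime_prod_gt0 R 0 i.
have [n hn] := series_harmonic_unbounded (prime_prod R 0 i * e)^-1.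
have ij : (i <= maxn i n.+1)%N by exact: leq_maxl.
exists (maxn i n.+1) => //; set j := maxn i n.+1 in ij *.
have Hn : series harmonic n = smooth_sum R j n.
  rewrite /series /= /smooth_sum [RHS]big_seq_cond.
  rewrite [RHS](eq_bigl (fun k => k \in iota 1 n)); last first.
    move=> k /=; apply: andb_idr; rewrite mem_iota add1n => /andP[k0 kn].
    apply/allP => p; rewrite mem_primes => /and3P[_ _ /(dvdn_leq k0) pk].
    by rewrite (leq_ltn_trans pk)// (leq_trans kn)// leq_maxr.
  by rewrite -big_seq -[1%N]addn0 iotaDl big_map /index_iota subn0.
have := smooth_sum_prime_prod_le1 R j n.
rewrite -Hn {1}/prime_prod (@big_cat_nat _ _ _ i)//= -!/(prime_prod _ _ _).
set x := series harmonic n in hn *; set c := prime_prod R 0 i in c0 hn *.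
set y := prime_prod R i j; move=> h.
have x0 : 0 < x by rewrite (lt_trans _ hn)// invr_gt0 mulr_gt0.
rewrite -(ltr_pM2l c0) -[ltRHS]invrK; apply: le_lt_trans (_ : x^-1 < _).
  by rewrite -[leRHS]mul1r ler_pdivlMr// mulrC.
by rewrite ltf_pV2 ?posrE ?invr_gt0 ?mulr_gt0.
Qed.

(** * Counting integers coprime to a product of primes, and the density criterion *)

Definition primorial (i j : nat) : nat := \prod_(i <= p < j | prime p) p.

Lemma primorial_gt0 i j : (0 < primorial i j)%N.
Proof. by apply: prodn_cond_gt0 => p /prime_gt0. Qed.

Lemma prime_dvd_primorial q i j :
  prime q -> (q %| primorial i j)%N -> (i <= q < j)%N.
Proof.
move=> pq; rewrite /primorial big_nat_cond.
elim/big_rec: _ => [|p x /andP[ipj pp] ih].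
  by rewrite dvdn1; case: eqP pq => // ->.
rewrite Euclid_dvdM// => /orP[|//].
by rewrite dvdn_prime2// => /eqP ->.
Qed.

Lemma totient_primorial (R : numFieldType) i j :
  (totient (primorial i j))%:R = (primorial i j)%:R * prime_prod R i j.
Proof.
elim: j => [|j ih].
  by rewrite /primorial /prime_prod !big_geq// mulr1.
have [ij|ji] := leqP i j; last first.
  by rewrite /primorial /prime_prod !big_geq// mulr1.
rewrite /primorial /prime_prod ![in LHS]big_mkcond [in RHS]big_mkcond /=.
rewrite [X in _ = _ * X]big_mkcond !big_nat_recr//= -!big_mkcond /=.
rewrite -/(primorial i j) -/(prime_prod R i j).
case: ifPn => [pj|_]; last by rewrite muln1 mulr1.
rewrite totient_coprime; last first.
  rewrite coprime_sym prime_coprime//; apply/negP => /(prime_dvd_primorial pj).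
  by rewrite ltnn andbF.
rewrite (totient_prime pj) natrM ih natrM -!mulrA; congr (_ * _).
rewrite mulrCA; congr (_ * _).
rewrite mulrBr mulr1 mulfV ?pnatr_eq0 -?lt0n ?prime_gt0//.
by rewrite -subn1 natrB// prime_gt0.
Qed.

(** Coprimality to [Q] is periodic modulo [Q], and each period contributes [totient Q]. *)
Lemma count_coprime_periods Q a :
  (\sum_(0 <= d < a * Q) coprime Q d = a * totient Q)%N.
Proof.
elim: a => [|a ih]; first by rewrite !mul0n big_geq.
rewrite mulSnr (@big_cat_nat _ _ _ (a * Q))//= ?leq_addr// ih mulSnr.
congr (_ + _)%N; rewrite totient_count_coprime -{1}[(a * Q)%N]add0n big_addn.
rewrite addKn; apply: eq_bigr => d _.
by rewrite addnC /coprime gcdnMDl.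
Qed.

Lemma count_coprime_le Q m : (0 < Q)%N ->
  (\sum_(0 <= d < m.+1) coprime Q d <= (m %/ Q).+1 * totient Q)%N.
Proof.
move=> Q0; rewrite -count_coprime_periods.
rewrite (@big_cat_nat _ _ _ m.+1 0 ((m %/ Q).+1 * Q))//= ?leq_addr//.
by rewrite ltn_ceil.
Qed.

Lemma card_fset_set_range (P : nat -> Prop) m :
  #|` fset_set [set N : nat | (1 <= N <= m)%N /\ P N]|%fset =
  (\sum_(1 <= N < m.+1) `[< P N >])%N.
Proof.
have fin : finite_set [set N : nat | (1 <= N <= m)%N /\ P N].
  apply: (sub_finite_set _ (finite_II m.+1)) => N /= [/andP[_ Nm] _].
  by rewrite ltnS.
rewrite -big_mkcond/= sum1_count -size_filter /index_iota subn1.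
apply/perm_size/uniq_perm; rewrite ?fset_uniq ?filter_uniq ?iota_uniq// => N.
rewrite in_fset_set// mem_filter mem_iota add1n ltnS /=.
by apply/idP/idP => [/set_mem[-> /asboolT ->]//|/andP[/asboolW PN N1m]];
  apply/mem_set.
Qed.

Lemma count_ltn_le (C m : nat) : (\sum_(0 <= N < m) (N < C) <= C)%N.
Proof.
suff -> : (\sum_(0 <= N < m) (N < C) = minn m C)%N by exact: geq_minr.
elim: m => [|m ih]; first by rewrite big_geq// min0n.
by rewrite big_nat_recr//= ih; lia.
Qed.

(** The maximum of finitely many thresholds serves all points. This gives uniformity over the primes
    dividing the modulus, and later over finite sets of field elements. *)
Lemma finite_set_eventually (T : eqType) (A : set T) (P : T -> nat -> Prop) :
  finite_set A -> (forall x, A x -> exists B, forall k, (B <= k)%N -> P x k) ->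
  exists B, forall x, A x -> forall k, (B <= k)%N -> P x k.
Proof.
move=> /finite_seqP[s ->]; elim: s => [|a s ih] H; first by exists 0%N.
have [B1 H1] := H a (mem_head _ _).
have [|B2 H2] := ih; first by move=> x xs; apply: H; rewrite /= inE xs orbT.
exists (maxn B1 B2) => x; rewrite /= inE => /orP[/eqP ->|xs] k.
  by rewrite geq_max => /andP[/H1].
by rewrite geq_max => /andP[_ /H2]; apply.
Qed.

Lemma density_one_of_multiples (R : realType) (P : nat -> Prop) (p0 : nat) :
  (forall p, prime p -> (p0 <= p)%N ->
     exists B, forall k, (B <= k)%N -> P (p * k)%N) ->
  (fun m : nat =>
    #|` fset_set [set N : nat | (1 <= N <= m)%N /\ P N]|%fset%:R / m%:R : R)
  @ \oo --> (1 : R).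
Proof.
move=> HP; apply/cvgrPdist_le => e e0.
(* Half of [e] pays for the integers coprime to [Q], the other half for the terms that stay bounded
   as [m] grows. *)
have e20 : 0 < e / 2 by rewrite divr_gt0.
have [j p0j hj] := prime_prod_small p0 e20.
set Q := primorial p0 j.
have Q0 : (0 < Q)%N := primorial_gt0 p0 j.
have [B HB] : exists B, forall p, prime p && (p %| Q)%N ->
    forall k, (B <= k)%N -> P (p * k)%N.
  apply: finite_set_eventually => [|p /andP[pp pQ]].
    apply: (sub_finite_set _ (finite_II Q.+1)) => p /= /andP[_ /dvdn_leq].
    by move=> /(_ Q0).
  by apply: HP => //; have /andP[] := prime_dvd_primorial pp pQ.
(* Each [N] from 1 to [m] satisfies [P], lies below [Q * B], or is coprime to [Q]. *)
have bound m : (m <= #|` fset_set [set N : nat | (1 <= N <= m)%N /\ P N]|%fset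
    + Q * B + (m %/ Q).+1 * totient Q)%N.
  have sum1 f : (\sum_(1 <= N < m.+1) f N <= \sum_(0 <= N < m.+1) f N)%N.
    by rewrite [leqRHS]big_ltn// leq_addl.
  have h1 := leq_trans (sum1 _) (count_ltn_le (Q * B) m.+1).
  have h2 := leq_trans (sum1 _) (count_coprime_le m Q0).
  apply: leq_trans (leq_add (leq_add (leqnn _) h1) h2).
  rewrite card_fset_set_range -!big_split /=.
  have {1}-> : m = (\sum_(1 <= N < m.+1) 1)%N.
    by rewrite sum_nat_const_nat muln1 subn1.
  rewrite big_nat_cond [leqRHS]big_nat_cond.
  apply: leq_sum => N /andP[/andP[N0 _] _].
  have [//|QBN] := ltnP N (Q * B); first by rewrite addnAC addn1.
  have [//|ncop] := boolP (coprime Q N); first by rewrite addn1.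
  (* Take a prime [p] dividing both [Q] and [N], and write [N = k * p]. From [p <= Q] and
     [Q * B <= N] follows [B <= k], so [HB] applies. *)
  have g1 : (1 < gcdn Q N)%N.
    by rewrite ltn_neqAle eq_sym ncop gcdn_gt0 Q0.
  have pp := pdiv_prime g1; have := pdiv_dvd (gcdn Q N).
  set p := pdiv _ in pp *; rewrite dvdn_gcd => /andP[pQ /dvdnP[k Nk]].
  suff /asboolT -> : P N by [].
  rewrite Nk mulnC; apply: HB; first by rewrite pp.
  rewrite -(leq_pmul2r (prime_gt0 pp)) -Nk (leq_trans _ QBN)// mulnC.
  by rewrite leq_mul2r dvdn_leq ?orbT.
near=> m.
have m0 : 0 < m%:R :> R by rewrite ltr0n; near: m; exact: nbhs_infty_gt.
have mle : #|` fset_set [set N : nat | (1 <= N <= m)%N /\ P N]|%fset%:R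
    <= m%:R :> R.
  rewrite ler_nat card_fset_set_range.
  rewrite (@leq_trans (\sum_(1 <= N < m.+1) 1)%N)//.
    by apply: leq_sum => N _; exact: leq_b1.
  by rewrite sum_nat_const_nat muln1 subn1.
set c := #|` _|%fset in mle bound *.
rewrite ger0_norm; last by rewrite subr_ge0 ler_pdivrMr// mul1r.
rewrite lerBlDr -lerBlDl ler_pdivlMr//.
have := bound m; rewrite -(ler_nat R) (natrD _ (_ + _)) (natrD _ c) !natrM.
set f := (totient Q)%:R; set d := (m %/ Q).+1%:R => h.
(* Split [d * f] as [(d - 1) * f + f]: the first term is at most [m] times the prime product, the
   second does not depend on [m]. *)
have fE : f = Q%:R * prime_prod R p0 j by exact: totient_primorial.
have dQ : (d - 1) * Q%:R <= m%:R.
  by rewrite /d -natr1 addrK -natrM ler_nat leq_divM.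
have mlarge : Q%:R * B%:R + f <= m%:R * (e / 2).
  by rewrite -ler_pdivrMr//; near: m; exact: nbhs_infty_ger.
have : (d - 1) * f <= m%:R * (e / 2).
  rewrite fE [leLHS]mulrA; apply: ler_pM => //; last exact: ltW.
    by rewrite /d -natr1 addrK -natrM ler0n.
  exact/ltW/prime_prod_gt0.
lra.
Unshelve. all: by end_near. Qed.

(** * Heights of an adelic structure *)

Lemma absv1 (R : realType) (K : fieldType) (v : absolute_value R K) : v 1 = 1.
Proof.
have v1 : v 1 != 0 by apply/eqP => /absv_eq0 /eqP; rewrite oner_eq0.
by apply: (mulfI v1); rewrite -absvM !mulr1.
Qed.

Lemma absvX (R : realType) (K : fieldType) (v : absolute_value R K) x k :
  v (x ^+ k) = v x ^+ k.
Proof. by elim: k => [|k ih]; rewrite ?expr0 ?absv1// !exprS absvM ih. Qed.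

Definition height (R : realType) (K : fieldType) (S : adelic_structure R K)
    (a : K) : \bar R :=
  (\int[adelic_measure S]_w (ln (Num.max (adelic_absv w a) 1))%:E)%E.

Lemma ln_max1_ge0 (R : realType) (x : R) : 0 <= ln (Num.max x 1).
Proof. by rewrite ln_ge0// le_max lexx orbT. Qed.

Lemma ln_max1X (R : realType) (x : R) k : 0 <= x ->
  ln (Num.max (x ^+ k) 1) = k%:R * ln (Num.max x 1).
Proof.
move=> x0; rewrite -[in LHS](expr1n R k).
have -> : Num.max (x ^+ k) (1 ^+ k) = Num.max x 1 ^+ k.
  case: k => [|k]; first by rewrite !expr0 maxxx.
  by have [x1|x1] := leP x 1; apply/max_idPr || apply/max_idPl;
    rewrite lerXn2r ?nnegrE// ltW.
by rewrite lnXn ?mulr_natl// lt_max ltr01 orbT.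
Qed.

(** For [a != 0] the integrand is the positive part of the integrable function [ln |a|]; for [a = 0]
    it vanishes. *)
Lemma integrable_ln_max1 (R : realType) (K : fieldType)
    (S : adelic_structure R K) (a : K) :
  (adelic_measure S).-integrable [set: adelic_space S]
    (fun w => (ln (Num.max (adelic_absv w a) 1))%:E).
Proof.
have [->|a0] := eqVneq a 0.
  apply: (eq_integrable _ (cst 0%E)) => // [w _|]; last exact: integrable0.
  by rewrite (absv_eq0 _ _).2// max_r ?ler01// ln1.
have := integrable_funepos measurableT (adelic_integrable S a0).
apply: eq_integrable => // w _; rewrite funeposE -EFin_max; congr EFin.
have w0 : 0 < adelic_absv w a.
  by rewrite lt_def absv_ge0 andbT; apply: contra a0 => /eqP/absv_eq0 ->.
have [w1|w1] := leP (adelic_absv w a) 1.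
  by rewrite ln1; apply/max_idPr; exact: ln_le0.
by apply/max_idPl; rewrite ln_ge0// ltW.
Qed.

Lemma height_ge0 (R : realType) (K : fieldType)
    (S : adelic_structure R K) a : (0 <= height S a)%E.
Proof. by apply: integral_ge0 => w _; rewrite lee_fin ln_max1_ge0. Qed.

Lemma height_fin_num (R : realType) (K : fieldType)
    (S : adelic_structure R K) a :
  height S a \is a fin_num.
Proof. exact: integrable_fin_num (integrable_ln_max1 S a). Qed.

Lemma heightX (R : realType) (K : fieldType)
    (S : adelic_structure R K) a k :
  height S (a ^+ k) = (k%:R%:E * height S a)%E.
Proof.
rewrite /height -ge0_integralZl_EFin//.
- by apply: eq_integral => w _; rewrite absvX ln_max1X// absv_ge0.
- by move=> w _; rewrite lee_fin ln_max1_ge0.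
- exact: measurable_int (integrable_ln_max1 S a).
Qed.

(** All powers of [a] have height 0, so by Northcott's property they form a finite set. If [a] were
    nonzero and not a root of unity, its powers would be pairwise distinct. *)
Lemma height_eq0 (R : realType) (K : fieldType)
    (S : adelic_structure R K) a :
  adelic_northcott S -> height S a = 0%E -> a = 0 \/ roots_of_unity K a.
Proof.
move=> northcottS ha; have [->|a0] := eqVneq a 0; [by left|right].
have fin := northcottS 0.
apply: contrapT => nroot; apply: infinite_nat.
have -> : [set: nat] = (fun i => a ^+ i) @^-1` [set x | (height S x <= 0%:E)%E].
  by apply/seteqP; split => // i _ /=; rewrite heightX ha mule0.
apply: finite_preimage => // i j _ _.
wlog ij : i j / (i <= j)%N => [H|].
  by have /orP[/H//|/H h /esym/h] := leq_total i j.
move: ij; rewrite leq_eqVlt => /orP[/eqP//|ij] /eqP.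
rewrite -(subnKC (ltnW ij)) exprD -subr_eq0 -{1}[a ^+ i]mulr1 -mulrBr mulf_eq0.
rewrite expf_eq0 (negbTE a0) andbF subr_eq0 /= => /eqP h.
by case: nroot; exists (j - i)%N; rewrite ?subn_gt0.
Qed.

(* The [x] with [x ^+ k] in a finite set have height bounded independently of
   [k >= 1], so only finitely many [x] occur, and those of positive height
   occur for boundedly many [k] because [height (x ^+ k) = k * height x]. *)
Lemma finite_set_roots (R : realType) (K : fieldType)
    (S : adelic_structure R K) (A : set K) :
  adelic_northcott S -> finite_set A ->
  exists B, forall k, (B <= k)%N ->
    forall x, A (x ^+ k) -> x = 0 \/ roots_of_unity K x.
Proof.
move=> northcottS finA.
(* [H] bounds the heights on [A]; the bound is phrased with a threshold so that
   [finite_set_eventually] yields it. *)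
have [H HA] : exists H, forall a, A a -> forall k, (H <= k)%N ->
    (height S a <= k%:R%:E)%E.
  apply: finite_set_eventually => // a _.
  exists (Num.truncn (fine (height S a))).+1 => k hk.
  rewrite -(fineK (height_fin_num S a)) lee_fin.
  by rewrite (le_trans (ltW (truncnS_gt _)))// ler_nat.
have [B HB] : exists B, forall x, (height S x <= H%:R%:E)%E ->
    forall k, (B <= k)%N ->
      A (x ^+ k) -> x = 0 \/ roots_of_unity K x.
  apply: finite_set_eventually; first exact: northcottS.
  move=> x _; have := height_ge0 S x; rewrite le_eqVlt.
  move=> /orP[/eqP/esym/(height_eq0 northcottS)|].
    by exists 0%N.
  rewrite -(fineK (height_fin_num S x)) lte_fin; set h := fine _ => h0.
  (* Beyond [H / h] the height [k * h] of [x ^+ k] exceeds [H], so [x ^+ k] is not in [A]. *)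
  exists (Num.truncn (H%:R / h)).+1 => k hk /HA /(_ H (leqnn _)).
  rewrite heightX -(fineK (height_fin_num S x)) -EFinM lee_fin -/h.
  rewrite leNgt => /negP[]; rewrite -ltr_pdivrMr//.
  by rewrite (lt_le_trans (truncnS_gt _))// ler_nat.
(* With [k >= 1] the height of [x] is at most that of [x ^+ k], hence at most [H]. *)
exists (maxn 1 B) => k; rewrite geq_max => /andP[k1 Bk] x Ax.
apply: (HB x _ k) => //; have := HA _ Ax H (leqnn _).
rewrite heightX; apply: le_trans.
by rewrite lee_pemull ?height_ge0// lee_fin ler1n.
Qed.

(** * Points of Fermat curves and the conclusion *)

Definition affine_vec (K : fieldType) (xy : K * K) : 'rV[K]_3 :=
  \row_j [:: xy.1; xy.2; 1]`_j.

(** The map from [(x, y)] to the line [(x : y : 1)] is injective: the last coordinate forces the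
    scalar between two spanning vectors to be 1. *)
Lemma affine_fermat_finite (K : fieldType) N :
  finite_set (fermat_points K N) ->
  finite_set [set xy : K * K | xy.1 ^+ N + xy.2 ^+ N = 1].
Proof.
move=> fin; apply: (@sub_finite_set _ _
  ((fun xy => <[affine_vec xy]>%VS) @^-1` fermat_points K N)).
  move=> [x y] /= xyN; exists (affine_vec (x, y)); split => //.
    apply/eqP => /rowP/(_ 2); rewrite !mxE /= => /eqP.
    by rewrite oner_eq0.
  by rewrite !mxE /= expr1n.
apply: finite_preimage fin => -[x y] [x' y'] _ _ /= eqv.
have /vlineP[k /rowP kE] : affine_vec (x, y) \in <[affine_vec (x', y')]>%VS.
  by rewrite -eqv memv_line.
have := kE 2; rewrite !mxE /= mulr1 => k1.
have := kE 0; rewrite !mxE /= -k1 mul1r => ->.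
by have := kE 1; rewrite !mxE /= -k1 mul1r => ->.
Qed.

Lemma fermat_property_multiple (R : realType) (K : fieldType)
    (S : adelic_structure R K) p :
  adelic_northcott S -> finite_set (fermat_points K p) ->
  exists B, forall k, (B <= k)%N -> fermat_property K (p * k).
Proof.
move=> nS /affine_fermat_finite fin.
(* The two coordinates are treated separately, through the finite projections of the set of affine
   points. *)
have [B1 H1] := finite_set_roots nS (finite_image fst fin).
have [B2 H2] := finite_set_roots nS (finite_image snd fin).
exists (maxn B1 B2) => k; rewrite geq_max => /andP[k1 k2] [x y] /= xy.
have {}xy : (x ^+ k) ^+ p + (y ^+ k) ^+ p = 1 by rewrite -!exprM mulnC.
by split; [apply: (H1 k k1) | apply: (H2 k k2)]; exists (x ^+ k, y ^+ k).
Qed.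

Theorem theorem0p1 (R : realType) (K : fieldType)
  (hadelic : exists S : adelic_structure R K,
    adelic_proper S /\ adelic_northcott S)
  (hfermat : exists2 p0 : nat, (0 < p0)%N &
    forall p : nat, prime p -> (p0 <= p)%N -> finite_set (fermat_points K p)) :
  (fun m : nat => (fermat_count K m)%:R / m%:R : R) @ \oo --> (1 : R).
Proof.
have [S [_ nS]] := hadelic; have [p0 _ fin] := hfermat.
apply: (@density_one_of_multiples R (fermat_property K) p0) => p pp p0p.
exact: fermat_property_multiple nS (fin p pp p0p).
Qed.
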